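(* Let $\gamma>0$ and consider the $L$-layer network with batch normalization in its last layer, the cross-entropy-after-softmax loss, and the SGD-with-weight-decay update $F$ with minibatches of size $m$, as defined in the context. Suppose that the scale parameter $a_L$ of the last batch normalization layer is initialized with $|a_L|\le 2\sqrt{m}/\gamma$, and that the step size satisfies $0<\eta\le 1/\gamma$. Then there is a constant $C$, independent of $n$ and $\delta$, such that for every $n\ge1$ and every $\delta\in(0,1/2]$, with probability at least $1-\delta$ the empirical measure $\mu_n=\frac1n\sum_{t=1}^n\delta_{\theta_t}$ of the SGD iterates satisfies $$\Big|\mathbb{E}_{\theta\sim\mu_n,\ \mathcal{B}\sim\mathcal{P}_{\mathcal{B}}}\big[L_{\mathcal{B}}(\theta)-L_{\mathcal{B}}(F(\theta))\big]\Big|\le C\,\frac{\log(1/\delta)}{\sqrt n},$$ where $\mathcal{P}_{\mathcal{B}}$ denotes the distribution of random minibatches.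
   Context: Data: $S=\{(x^i,y^i)\}_{i=1}^N$ with $\|x^i\|_2\le1$, $y^i\in[d]=\{1,\dots,d\}$. $\mathcal{P}_{\mathcal{B}}$ is a fixed distribution over minibatches $\mathcal{B}$ consisting of $m$ examples of $S$. Network: given a minibatch $\mathcal{B}$, set $x_0^i=x^i$ for $i\in\mathcal{B}$. The $l$-th layer ($l=1,\dots,L$) maps $\{x_{l-1}^i\}_{i\in\mathcal{B}}$ to $\{x_l^i\}_{i\in\mathcal{B}}$ and is either an ordinary layer $x_l^i=\sigma_l(W_{l-1}x_{l-1}^i)$, with $\sigma_l$ a (sub)differentiable activation function applied coordinate-wise (e.g. ReLU or sigmoid), or a batch normalization layer $$\mu_{\mathcal{B},l-1}=\tfrac1m\sum_{i\in\mathcal{B}}x_{l-1}^i,\qquad \sigma^2_{\mathcal{B},l-1}=\tfrac1m\sum_{i\in\mathcal{B}}(x_{l-1}^i-\mu_{\mathcal{B},l-1})^2,$$ $$\hat x_l^i=\frac{x_{l-1}^i-\mu_{\mathcal{B},l-1}}{\sqrt{\sigma_{\mathcal{B},l-1}^2+\epsilon}},\qquad x_l^i=a_l\cdot\hat x_l^i+b_l,$$ where squares, square roots and quotients of vectors are coordinate-wise, $\epsilon>0$ is fixed, and $a_l,b_l\in\mathbb{R}$ are trainable scale and shift parameters ($b_l$ being added to every coordinate). The last layer ($l=L$) is a batch normalization layer, with output $x_L^i\in\mathbb{R}^d$. $\theta$ denotes the collection of all trainable parameters (all matrices $W_l$ and all $a_l,b_l$). Loss: $\ell(x,y)=x_y-\log\big(\sum_{j=1}^d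 e^{x_j}\big)$ for $x\in\mathbb{R}^d$, $y\in[d]$, and $L_{\mathcal{B}}(\theta)=\frac1m\sum_{i\in\mathcal{B}}\ell(x_L^i,y^i)$, with $x_L^i$ computed using the batch statistics of $\mathcal{B}$. SGD with weight decay: one (random) step with step size $\eta$ is $F(\theta)=(1-\eta\gamma)\theta-\eta\nabla_\theta L_{\mathcal{B}'}(\theta)$ with $\mathcal{B}'\sim\mathcal{P}_{\mathcal{B}}$ (gradients by the chain rule, with a chosen (sub)derivative for the activations). The iterates are $\theta_{t+1}=F(\theta_t)$, with an independent minibatch at each step, started from a fixed initial point $\theta_1$. $\delta_\theta$ denotes the Dirac measure at $\theta$. The probability is over the randomness of the SGD trajectory. In the displayed expectation, the trajectory is given, and one averages over $\theta\sim\mu_n$, over the evaluation batch $\mathcal{B}\sim\mathcal{P}_{\mathcal{B}}$, and over a fresh minibatch $\mathcal{B}'$ used in $F$, independent of $\mathcal{B}$ and of the trajectory; i.e. with $\phi(\theta)=\mathbb{E}_{\mathcal{B}\sim\mathcal{P}_{\mathcal{B}}}[L_{\mathcal{B}}(\theta)]$ it equals $\frac1n\sum_{t=1}^n\big(\phi(\theta_t)-\mathbb{E}_F[\phi(F(\theta_t))\mid\theta_t]\big)$. *)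

(* Defs.v *)
From HB Require Import structures.
From mathcomp Require Import all_boot all_order all_algebra.
From mathcomp Require Import all_classical all_reals all_analysis.

Set Implicit Arguments.
Unset Strict Implicit.
Unset Printing Implicit Defensive.

Import Order.TTheory GRing.Theory Num.Theory.
Import numFieldNormedType.Exports.

Local Open Scope classical_set_scope.
Local Open Scope ring_scope.

Section Activations.
Context {R : realType}.

(* [g] is a Frechet subgradient of [f] at [z]. If [f] is differentiable at [z],
   the only such [g] is the derivative; for ReLU at 0 they are the points of
   [0, 1]. *)
Definition subgradient (f : R -> R) (z g : R) : Prop :=
  forall e : R, 0 < e ->
    \forall y \near z, f z + g * (y - z) - e * `|y - z| <= f y.

(* Supergradients are allowed as well, so that concave kinks (hard tanh, ReLU6)
   are covered. *)
Definition subderivative (f : R -> R) (z g : R) : Prop :=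
  subgradient f z g \/ subgradient (\- f) z (- g).

Record activation : Type := Activation {
  act :> R -> R;
  dact : R -> R;
  dactP : forall z : R, subderivative act z (dact z)
}.

End Activations.

Arguments activation : clear implicits.

Section Network.
Context {R : realType}.

Inductive layer : nat -> nat -> Type :=
  | Dense (p q : nat) (s : activation R) : layer p q
  | BatchNorm (p : nat) : layer p p.

(* [Layer N c] puts the layer [c] after (on the output side of) [N]; the
   outermost constructor is the last layer. *)
Inductive net : nat -> nat -> Type :=
  | Input (p : nat) : net p p
  | Layer (p q r : nat) (N : net p q) (c : layer q r) : net p r.

(* The trainable parameters: a weight matrix for an ordinary layer, the pair
   (scale, shift) for a batch normalization layer. *)
Definition layer_param (p q : nat) (c : layer p q) : lmodType R :=
  match c with
  | Dense p q _ => 'M[R]_(q, p)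
  | BatchNorm _ => (R^o * R^o)%type
  end.

Fixpoint param (p q : nat) (N : net p q) : lmodType R :=
  match N with
  | Input _ => 'M[R]_(0, 0)
  | Layer _ _ _ N c => (param N * layer_param c)%type
  end.

(* Throughout, the activations of a minibatch of size [m] are the columns of a
   matrix with [m] columns. *)

Definition bn_mean (m p : nat) (X : 'M[R]_(p, m)) (k : 'I_p) : R :=
  m%:R^-1 * \sum_(i < m) X k i.

Definition bn_var (m p : nat) (X : 'M[R]_(p, m)) (k : 'I_p) : R :=
  m%:R^-1 * \sum_(i < m) (X k i - bn_mean X k) ^+ 2.

Definition bn_normalize (eps : R) (m p : nat) (X : 'M[R]_(p, m)) : 'M[R]_(p, m) :=
  \matrix_(k, i) ((X k i - bn_mean X k) / Num.sqrt (bn_var X k + eps)).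

Definition batchnorm (eps : R) (m p : nat) (a b : R) (X : 'M[R]_(p, m)) :
    'M[R]_(p, m) :=
  \matrix_(k, i) (a * bn_normalize eps X k i + b).

Definition layer_forward (eps : R) (m p q : nat) (c : layer p q) :
    layer_param c -> 'M[R]_(p, m) -> 'M[R]_(q, m) :=
  match c in layer p q return layer_param c -> 'M[R]_(p, m) -> 'M[R]_(q, m) with
  | Dense _ _ s => fun W X => map_mx s (W *m X)
  | BatchNorm _ => fun ab X => batchnorm eps ab.1 ab.2 X
  end.

Fixpoint forward (eps : R) (m p q : nat) (N : net p q) :
    param N -> 'M[R]_(p, m) -> 'M[R]_(q, m) :=
  match N in net p q return param N -> 'M[R]_(p, m) -> 'M[R]_(q, m) with
  | Input _ => fun _ X => X
  | Layer _ _ _ N c => fun th X => layer_forward eps th.2 (forward eps th.1 X)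
  end.

(* Chain rule through one layer: the derivative of its output when its
   parameters move in the direction [dw] and its input in the direction [dX].
   Batch normalization is differentiated through the batch statistics. *)
Definition layer_tangent (eps : R) (m p q : nat) (c : layer p q) :
    layer_param c -> layer_param c -> 'M[R]_(p, m) -> 'M[R]_(p, m) ->
    'M[R]_(q, m) :=
  match c in layer p q
    return layer_param c -> layer_param c -> 'M[R]_(p, m) -> 'M[R]_(p, m) ->
           'M[R]_(q, m) with
  | Dense _ _ s => fun W dW X dX =>
      \matrix_(k, i) (dact s ((W *m X) k i) * (dW *m X + W *m dX) k i)
  | BatchNorm _ => fun ab dab X dX =>
      \matrix_(k, i)
        derive1 (fun t : R => batchnorm eps (ab.1 + t * dab.1) (ab.2 + t * dab.2)
                                        (X + t *: dX) k i) 0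
  end.

(* Chain rule through the whole network, the network input being fixed. *)
Fixpoint tangent (eps : R) (m p q : nat) (N : net p q) :
    param N -> param N -> 'M[R]_(p, m) -> 'M[R]_(q, m) :=
  match N in net p q
    return param N -> param N -> 'M[R]_(p, m) -> 'M[R]_(q, m) with
  | Input _ => fun _ _ _ => 0
  | Layer _ _ _ N c => fun th dth X =>
      layer_tangent eps th.2 dth.2 (forward eps th.1 X) (tangent eps th.1 dth.1 X)
  end.

(* The vector of the values of [D] on the coordinate directions: the gradient,
   when [D] maps a direction to the derivative in that direction. *)
Definition layer_gradient (p q : nat) (c : layer p q) :
    (layer_param c -> R) -> layer_param c :=
  match c in layer p q return (layer_param c -> R) -> layer_param c with
  | Dense _ _ _ => fun D => \matrix_(i, j) D (delta_mx i j)
  | BatchNorm _ => fun D => (D (1, 0), D (0, 1))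
  end.

Fixpoint gradient (p q : nat) (N : net p q) : (param N -> R) -> param N :=
  match N in net p q return (param N -> R) -> param N with
  | Input _ => fun _ => 0
  | Layer _ _ _ N c => fun D =>
      (gradient (fun v : param N => D (v, 0)),
       layer_gradient (fun w : layer_param c => D (0, w)))
  end.

Definition bn_net (p d : nat) (N : net p d) : net p d := Layer N (BatchNorm d).

Definition last_scale (p d : nat) (N : net p d) (th : param (bn_net N)) : R :=
  th.2.1.

End Network.

Arguments layer : clear implicits.
Arguments net : clear implicits.

Section Training.
Context {R : realType}.

Definition norm2 (p : nat) (v : 'cV[R]_p) : R := Num.sqrt (\sum_k v k 0 ^+ 2).

Definition loss (d : nat) (v : 'I_d -> R) (y : 'I_d) : R :=
  v y - ln (\sum_(j < d) expR (v j)).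

(* A minibatch of size [m] out of [N] examples is a tuple of indices. Tuples
   with repetitions are not excluded: sampling with or without replacement is a
   matter of the support of the minibatch distribution. *)

Definition batch_input (N m p : nat) (x : 'I_N -> 'cV[R]_p)
    (B : m.-tuple 'I_N) : 'M[R]_(p, m) :=
  \matrix_(k, i) x (tnth B i) k 0.

Definition output_loss (N m d : nat) (y : 'I_N -> 'I_d) (B : m.-tuple 'I_N)
    (Z : 'M[R]_(d, m)) : R :=
  m%:R^-1 * \sum_(i < m) loss (fun k => Z k i) (y (tnth B i)).

Definition batch_loss (eps : R) (N m p d : nat) (x : 'I_N -> 'cV[R]_p)
    (y : 'I_N -> 'I_d) (nn : net R p d) (B : m.-tuple 'I_N) (th : param nn) : R :=
  output_loss y B (forward eps th (batch_input x B)).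

Definition batch_loss_deriv (eps : R) (N m p d : nat) (x : 'I_N -> 'cV[R]_p)
    (y : 'I_N -> 'I_d) (nn : net R p d) (B : m.-tuple 'I_N)
    (th dth : param nn) : R :=
  derive1 (fun t : R => output_loss y B
             (forward eps th (batch_input x B)
              + t *: tangent eps th dth (batch_input x B))) 0.

Definition sgd_step (eps eta gamma : R) (N m p d : nat) (x : 'I_N -> 'cV[R]_p)
    (y : 'I_N -> 'I_d) (nn : net R p d) (B : m.-tuple 'I_N) (th : param nn) :
    param nn :=
  (1 - eta * gamma) *: th - eta *: gradient (batch_loss_deriv eps x y B th).

(* [sgd_iter ... Bs th1 t] is the iterate number [t.+1]: it starts from [th1]
   at [t = 0] and uses the minibatches [Bs 0], ..., [Bs t.-1]. *)
Fixpoint sgd_iter (eps eta gamma : R) (N m p d : nat) (x : 'I_N -> 'cV[R]_p)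
    (y : 'I_N -> 'I_d) (nn : net R p d) (Bs : nat -> m.-tuple 'I_N)
    (th1 : param nn) (t : nat) : param nn :=
  if t is t'.+1 then
    sgd_step eps eta gamma x y (Bs t') (sgd_iter eps eta gamma x y Bs th1 t')
  else th1.

Definition is_pmf (T : finType) (pr : T -> R) : Prop :=
  (forall u, 0 <= pr u) /\ \sum_u pr u = 1.

Definition fin_mean (T : finType) (pr : T -> R) (f : T -> R) : R :=
  \sum_u pr u * f u.

(* Expectation under the empirical measure
   n^-1 * (dirac (th 0) + ... + dirac (th n.-1)). *)
Definition empirical_mean (V : Type) (n : nat) (th : nat -> V) (f : V -> R) : R :=
  n%:R^-1 * \sum_(t < n) f (th t).

(* [Bs t], t = 0, 1, ..., are random elements of the finite type [T], mutually
   independent, each with probability mass function [pr]. *)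
Definition iid (dsp : measure_display) (Om : measurableType dsp)
    (P : probability Om R) (T : finType) (pr : T -> R)
    (Bs : nat -> Om -> T) : Prop :=
  [/\ forall (t : nat) (u : T), measurable (Bs t @^-1` [set u]),
      forall (t : nat) (u : T), P (Bs t @^-1` [set u]) = (pr u)%:E &
      forall (J : seq nat) (A : nat -> set T), uniq J ->
        P (\bigcap_(t in [set` J]) (Bs t @^-1` A t))
        = (\prod_(t <- J) fine (P (Bs t @^-1` A t)))%:E].

End Training.

(* Main.v *)
Require Import Defs.
From HB Require Import structures.
From mathcomp Require Import all_boot all_order all_algebra.
From mathcomp Require Import all_classical all_reals all_analysis.
From mathcomp Require Import ring lra.

Set Implicit Arguments.
Unset Strict Implicit.
Unset Printing Implicit Defensive.

Import Order.TTheory GRing.Theory Num.Theory.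
Import numFieldNormedType.Exports.

Local Open Scope classical_set_scope.
Local Open Scope ring_scope.

(** With [phi th] the mean of the batch losses at [th], the averaged drift
    [phi th_t - E (phi (F th_t))] telescopes up to the martingale differences
    [phi th_(t+1) - E (phi (F th_t))], so only the boundedness of [phi] along the
    trajectory and an Azuma-type tail bound are needed.

    Normalized coordinates are bounded by [sqrt m], hence the derivative of the
    batch loss in the last scale is bounded by [2 sqrt m]; thanks to weight decay the
    interval [`|a_L| <= 2 sqrt m / gamma] is invariant under every SGD step. The loss
    does not change when a constant is added to all the logits, so it is bounded in
    terms of [a_L] alone, whatever the other parameters are.

    As a deviation linear in [ln (1 / delta)] is allowed, one exponential moment with
    rate of order [1 / (K sqrt n)] replaces the sub-Gaussian estimate. It is computed
    by summing over finite tuples of minibatches, peeling off the first one. *)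

(** * Batch normalization: bounds on the last scale and on the loss *)

Lemma bn_normalize_bounded (R : realType) (eps : R) (m p : nat) (X : 'M[R]_(p, m)) k i :
  0 < eps -> `|bn_normalize eps X k i| <= Num.sqrt m%:R.
Proof.
move=> eps_gt0.
have m_gt0 : 0 < m%:R :> R by rewrite ltr0n (leq_ltn_trans _ (ltn_ord i)).
have var_ge0 : 0 <= bn_var X k.
  by rewrite mulr_ge0 ?invr_ge0 ?ler0n// sumr_ge0// => j _; rewrite sqr_ge0.
have s_gt0 : 0 < bn_var X k + eps by rewrite ltr_wpDl.
rewrite mxE normrM normfV [X in _ / X]ger0_norm ?sqrtr_ge0//.
rewrite ler_pdivrMr ?sqrtr_gt0// -sqrtrM ?ler0n// -sqrtr_sqr.
rewrite ler_wsqrtr// mulrDr /bn_var mulrA mulfV ?gt_eqF// mul1r.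
(* [m * bn_var] is a sum of squared deviations that contains the one of [i]; the other squares and
   [m * eps] are nonnegative. *)
rewrite (bigD1 i)//= -addrA lerDl addr_ge0 ?mulr_ge0 ?ler0n ?(ltW eps_gt0)//.
by rewrite sumr_ge0// => j _; rewrite sqr_ge0.
Qed.

Lemma layer_tangent0 (R : realType) (eps : R) (m p q : nat) (c : layer R p q)
    (w : layer_param c) (X : 'M[R]_(p, m)) : layer_tangent eps w 0 X 0 = 0.
Proof.
case: c w X => [{}p {}q s|{}p] w X; apply/matrixP => k i; rewrite mxE [RHS]mxE.
  by rewrite mulmx0 addr0 (mul0mx _ X) [Z in _ * Z]mxE mulr0.
under eq_fun do rewrite scaler0 addr0 !mulr0 !addr0.
by rewrite derive1_cst.
Qed.

(** For a direction that moves only the last layer, this freezes all the layers below. *)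
Lemma tangent0 (R : realType) (eps : R) (m p q : nat) (N : net R p q) (th : param N)
    (X : 'M[R]_(p, m)) : tangent eps th 0 X = 0.
Proof.
by elim: N m th X => [//|{}p {}q r N IH c] m [th w] X /=; rewrite IH layer_tangent0.
Qed.

(** With its input frozen, the last layer is affine in its scale, and the slope is the normalized
    input. *)
Lemma tangent_last_scale (R : realType) (eps : R) (m p d : nat) (nn : net R p d)
    (th : param (bn_net nn)) (X : 'M[R]_(p, m)) :
  tangent eps th (0, (1, 0)) X = bn_normalize eps (forward eps th.1 X).
Proof.
apply/matrixP => k i; rewrite /= tangent0 !mxE.
under eq_fun do rewrite scaler0 addr0 mulr1 mulr0 addr0 mxE.
rewrite derive1E.
set c := bn_normalize _ _ _ _.
have : is_derive (0 : R) (1 : R)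
  (fun t : R => (th.2.1 + t) * c + th.2.2) c.
  by apply: is_derive_eq; rewrite /GRing.scale/=; ring.
by move=> ?; rewrite derive_val /c mxE.
Qed.

(** The derivative is [dv y] minus the softmax average of [dv], and both terms are at most [K] in
    absolute value. *)
Lemma loss_deriv_bounded (R : realType) (d : nat) (v dv : 'I_d -> R) (y : 'I_d) (K : R) :
  (forall j, `|dv j| <= K) ->
  exists2 l, is_derive (0 : R) (1 : R) (fun t : R => loss (fun j => v j + t * dv j) y) l
    & `|l| <= 2 * K.
Proof.
move=> dvK.
set E := \sum_(j < d) expR (v j).
have E_gt0 : 0 < E.
  by rewrite /E (bigD1 y)//= ltr_pwDl ?expR_gt0// sumr_ge0.
exists (dv y - E^-1 * \sum_(j < d) expR (v j) * dv j).
  have dE : is_derive (0 : R) (1 : R)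
      (\sum_(j < d) (fun t : R => expR (v j + t * dv j)))
      (\sum_(j < d) expR (v j) * dv j).
    apply: is_derive_sum => j.
    have dlin : is_derive (0 : R) (1 : R) (fun t : R => v j + t * dv j) (dv j).
      by apply: is_derive_eq; rewrite /GRing.scale/=; ring.
    apply: is_derive_eq.
    by rewrite mul0r addr0 mulrC.
  have E0 : (\sum_(j < d) (fun t : R => expR (v j + t * dv j))) 0 = E.
    by rewrite fct_sumE; apply: eq_bigr => j _; rewrite mul0r addr0.
  have dln : is_derive ((\sum_(j < d) (fun t : R => expR (v j + t * dv j))) 0)
     (1 : R) (@ln R) E^-1.
    by rewrite E0; exact: is_derive1_ln.
  have -> : (fun t : R => loss (fun j => v j + t * dv j) y) =
     (fun t => v y + t * dv y) -
       (@ln R \o (\sum_(j < d) (fun t : R => expR (v j + t * dv j)))).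
    by apply/funext => t; rewrite /loss !fctE /= fct_sumE.
  have dlin : is_derive (0 : R) (1 : R) (fun t : R => v y + t * dv y) (dv y).
    by apply: is_derive_eq; rewrite /GRing.scale/=; ring.
  exact: is_deriveB.
rewrite mulr_natl mulr2n (le_trans (ler_normB _ _))// lerD//.
rewrite normrM gtr0_norm ?invr_gt0// mulrC ler_pdivrMr// (le_trans (ler_norm_sum _ _ _))//.
rewrite /E mulr_sumr ler_sum// => j _.
by rewrite normrM gtr0_norm ?expR_gt0// mulrC ler_wpM2r ?expR_ge0.
Qed.

Lemma last_scale_deriv_bounded (R : realType) (N m p d : nat)
    (x : 'I_N -> 'cV[R]_p) (y : 'I_N -> 'I_d) (eps : R)
    (nn : net R p d) (B : m.-tuple 'I_N) (th : param (bn_net nn)) :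
  (0 < m)%N -> 0 < eps ->
  `|batch_loss_deriv eps x y B th (0, (1, 0))| <= 2 * Num.sqrt m%:R.
Proof.
move=> m_gt0 eps_gt0; rewrite /batch_loss_deriv tangent_last_scale.
set X := bn_normalize _ _; set Z := forward _ _ _.
have dl i := loss_deriv_bounded (fun k => Z k i) (y (tnth B i))
  (fun k => bn_normalize_bounded (forward eps th.1 (batch_input x B)) k i eps_gt0).
pose l i := s2val (cid2 (dl i)).
have dlP i : is_derive (0 : R) (1 : R) (fun t : R => loss (fun k => Z k i + t * X k i)
    (y (tnth B i))) (l i) by exact: (s2valP (cid2 (dl i))).
have lK i : `|l i| <= 2 * Num.sqrt m%:R by exact: (s2valP' (cid2 (dl i))).
have -> : (fun t : R => output_loss y B (Z + t *: X)) =
   m%:R^-1 *: \sum_(i < m) (fun t : R => loss (fun k => Z k i + t * X k i) (y (tnth B i))).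
  apply/funext => t; rewrite /output_loss !fctE fct_sumE; congr (_ * _).
  apply: eq_bigr => i _; congr loss.
  by apply/funext => k; rewrite !mxE.
rewrite derive1E.
have ds := is_derive_sum dlP.
have : is_derive (0 : R) (1 : R) (m%:R^-1 *: \sum_(i < m) (fun t : R => loss (fun k => Z k i + t * X k i) (y (tnth B i)))) (m%:R^-1 *: \sum_i l i).
  exact: is_deriveZ.
move=> ?; rewrite derive_val /GRing.scale/= normrM gtr0_norm ?invr_gt0 ?ltr0n//.
rewrite mulrC ler_pdivrMr ?ltr0n// (le_trans (ler_norm_sum _ _ _))//.
rewrite (le_trans (ler_sum _ (fun i _ => lK i)))//.
by rewrite sumr_const card_ord mulr_natr.
Qed.

(** As [eta * gamma <= 1], the new scale is a convex combination of the old one and of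
    [- g / gamma], where [g] is the derivative of the loss in the scale; both lie in the interval
    since [g] is at most [2 sqrt m] in absolute value. *)
Lemma last_scale_sgd_step (R : realType) (N m p d : nat)
    (x : 'I_N -> 'cV[R]_p) (y : 'I_N -> 'I_d) (eps gamma eta : R)
    (nn : net R p d) (B : m.-tuple 'I_N) (th : param (bn_net nn)) :
  (0 < m)%N -> 0 < eps -> 0 < gamma -> 0 < eta <= 1 / gamma ->
  `|last_scale th| <= 2 * Num.sqrt m%:R / gamma ->
  `|last_scale (sgd_step eps eta gamma x y B th)| <= 2 * Num.sqrt m%:R / gamma.
Proof.
move=> m_gt0 eps_gt0 gamma_gt0 /andP[eta_gt0 eta_le] ha.
(* By computation, the last-scale entry of [gradient] is the derivative in the direction
   [(0, (1, 0))]. *)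
have -> : last_scale (sgd_step eps eta gamma x y B th) =
    (1 - eta * gamma) * last_scale th
    - eta * batch_loss_deriv eps x y B th (0, (1, 0)) by [].
have eg : 0 <= 1 - eta * gamma by rewrite subr_ge0 -ler_pdivlMr.
rewrite (le_trans (ler_normB _ _))// !normrM (ger0_norm eg) (gtr0_norm eta_gt0).
set M := _ / gamma in ha *.
have -> : M = (1 - eta * gamma) * M + eta * (2 * Num.sqrt m%:R).
  by rewrite /M; field; rewrite gt_eqF.
rewrite lerD// ler_wpM2l ?(ltW eta_gt0)//.
exact: last_scale_deriv_bounded.
Qed.

(** The log-sum-exp lies between [v y] and [ln d + b + A], while [v y >= b - A]; the common offset
    [b] cancels. *)
Lemma loss_bounded (R : realType) (d : nat) (v : 'I_d -> R) (y : 'I_d) (b A : R) :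
  (forall j, `|v j - b| <= A) -> `|loss v y| <= 2 * A + ln d%:R.
Proof.
move=> vA.
have vA' j : b - A <= v j <= b + A by have := vA j; rewrite ler_norml; lra.
have d_gt0 : (0 < d)%N by rewrite (leq_ltn_trans _ (ltn_ord y)).
set E := \sum_(j < d) expR (v j).
have yE : expR (v y) <= E.
  by rewrite /E (bigD1 y)//= lerDl sumr_ge0.
have E_gt0 : 0 < E by rewrite (lt_le_trans _ yE)// expR_gt0.
have lnE_ge : v y <= ln E.
  by rewrite -{1}(expRK (v y)) ler_ln ?posrE ?expR_gt0.
have lnE_le : ln E <= ln d%:R + (b + A).
  rewrite -[X in _ + X]expRK -lnM ?posrE ?ltr0n ?expR_gt0//.
  rewrite ler_ln ?posrE ?mulr_gt0 ?ltr0n ?expR_gt0//.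
  have -> : d%:R * expR (b + A) = \sum_(j < d) expR (b + A).
    by rewrite sumr_const card_ord mulr_natl.
  by apply: ler_sum => j _; rewrite ler_expR; case/andP: (vA' j).
rewrite /loss -/E ler_norml.
by have := vA' y; lra.
Qed.

Lemma batch_loss_bounded (R : realType) (N m p d : nat)
    (x : 'I_N -> 'cV[R]_p) (y : 'I_N -> 'I_d) (eps M : R)
    (nn : net R p d) (B : m.-tuple 'I_N) (th : param (bn_net nn)) :
  (0 < m)%N -> 0 < eps -> `|last_scale th| <= M ->
  `|batch_loss eps x y B th| <= 2 * (M * Num.sqrt m%:R) + ln d%:R.
Proof.
move=> m_gt0 eps_gt0 ha; rewrite /batch_loss /output_loss.
rewrite normrM gtr0_norm ?invr_gt0 ?ltr0n// mulrC ler_pdivrMr ?ltr0n//.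
rewrite (le_trans (ler_norm_sum _ _ _))// mulr_natr -[X in _ *+ X]card_ord -sumr_const.
(* The offset is the shift [th.2.2], common to all coordinates; what remains is the scale times a
   normalized coordinate. *)
apply: ler_sum => i _; apply: (@loss_bounded _ _ _ _ th.2.2) => k.
rewrite mxE addrK normrM ler_pM//.
exact: bn_normalize_bounded.
Qed.

(** * Exponential tail of the noise over finite sequences of minibatches *)

Lemma big_tuple_cons (R : realType) (T : finType) (n : nat) (F : seq T -> R) :
  \sum_(b : n.+1.-tuple T) F b = \sum_u \sum_(b : n.-tuple T) F (u :: b).
Proof.
rewrite pair_big/= (reindex (fun ub : T * n.-tuple T => [tuple of ub.1 :: ub.2]))//=.
exists (fun b : n.+1.-tuple T => (thead b, [tuple of behead b])) => [[u b] _|b _] /=.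
  by congr pair; apply: val_inj.
by rewrite [RHS]tuple_eta; apply: val_inj.
Qed.

Section MarkovNoise.
Context {R : realType} {V : Type} {T : finType}.
Variables (pr : T -> R) (step : T -> V -> V) (phi : V -> R).

Let state (v : V) (b : seq T) : V := foldl (fun w u => step u w) v b.

(** The martingale difference of [phi] along the chain, given the current state [v]. *)
Definition innovation (v : V) (u : T) : R :=
  phi (step u v) - fin_mean pr (fun u' => phi (step u' v)).

(** Recursion on the first minibatch, with a varying starting state, fits the induction of
    [noise_moment]. *)
Fixpoint noise (v : V) (b : seq T) : R :=
  if b is u :: b' then innovation v u + noise (step u v) b' else 0.

Lemma noise_rcons v b u :
  noise v (rcons b u) = noise v b + innovation (state v b) u.
Proof.
elim: b v => [|u' b IH] v /=; first by rewrite addr0 add0r.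
by rewrite IH addrA.
Qed.

(** Each drift term is the decrease of [phi] along the actual step plus an innovation, and the
    decreases telescope. *)
Lemma sum_drift_noise (v : V) (Bs : nat -> T) n :
  \sum_(t < n) (phi (state v (mkseq Bs t)) -
     fin_mean pr (fun u => phi (step u (state v (mkseq Bs t))))) =
  phi v - phi (state v (mkseq Bs n)) + noise v (mkseq Bs n).
Proof.
elim: n => [|n IH]; first by rewrite big_ord0 /= subrr addr0.
rewrite mkseqS big_ord_recr/= IH noise_rcons /state foldl_rcons /innovation.
by ring.
Qed.

Hypothesis prP : is_pmf pr.

Lemma fin_mean_cst c : fin_mean pr (fun=> c) = c.
Proof. by rewrite /fin_mean -mulr_suml prP.2 mul1r. Qed.

Lemma fin_meanD f g : fin_mean pr (fun u => f u + g u) = fin_mean pr f + fin_mean pr g.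
Proof. by rewrite /fin_mean -big_split; apply: eq_bigr => u _; rewrite mulrDr. Qed.

Lemma fin_meanZ c f : fin_mean pr (fun u => c * f u) = c * fin_mean pr f.
Proof. by rewrite /fin_mean mulr_sumr; apply: eq_bigr => u _; rewrite mulrCA. Qed.

Lemma le_fin_mean f g : (forall u, f u <= g u) -> fin_mean pr f <= fin_mean pr g.
Proof. by move=> fg; apply: ler_sum => u _; rewrite ler_wpM2l ?prP.1. Qed.

Lemma fin_mean_bounded f c : (forall u, `|f u| <= c) -> `|fin_mean pr f| <= c.
Proof.
move=> fc; rewrite ler_norml -{1}(fin_mean_cst (- c)) -{2}(fin_mean_cst c).
by apply/andP; split; apply: le_fin_mean => u; have := fc u; rewrite ler_norml => /andP[].
Qed.

Lemma fin_mean_innovation v : fin_mean pr (innovation v) = 0.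
Proof. by rewrite fin_meanD fin_mean_cst subrr. Qed.

Variables (inv : V -> Prop) (K : R).
Hypothesis step_inv : forall u v, inv v -> inv (step u v).
Hypothesis phiK : forall v, inv v -> `|phi v| <= K.

Lemma innovation_bounded v u : inv v -> `|innovation v u| <= 2 * K.
Proof.
move=> iv; rewrite mulr_natl mulr2n (le_trans (ler_normB _ _))// lerD//.
  exact/phiK/step_inv.
by apply: fin_mean_bounded => u'; exact/phiK/step_inv.
Qed.

Lemma state_inv v b : inv v -> inv (state v b).
Proof. by elim: b v => //= u b IH v iv; apply/IH/step_inv. Qed.

(* By [expR u = (expR (- u))^-1 <= (1 - u)^-1]. *)
Lemma expR_le_quadratic (u : R) : u <= 1 / 2 -> expR u <= 1 + u + 2 * u ^+ 2.
Proof.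
move=> u2; rewrite -[u in expR u]opprK expRN.
have u1 : 0 < 1 - u by lra.
rewrite (@le_trans _ _ (1 - u)^-1)//.
  by rewrite lef_pV2 ?posrE ?expR_gt0// expR_ge1Dx.
rewrite -div1r ler_pdivrMr//.
(* This product equals [(1 + u + 2 * u ^+ 2) * (1 - u) - 1]. *)
have : 0 <= u ^+ 2 * (1 - 2 * u) by rewrite mulr_ge0 ?sqr_ge0//; lra.
by nra.
Qed.

(** The expectation under the product law of [n] independent minibatches, as a finite sum. *)
Definition prefix_mean n (F : seq T -> R) : R :=
  \sum_(b : n.-tuple T) (\prod_(u <- b) pr u) * F b.

(** Condition on the first minibatch: the induction hypothesis bounds the rest uniformly over the
    invariant set, and in the quadratic bound on the first factor the linear term averages to
    zero. *)
Lemma noise_moment (l : R) n v : `|l| * (2 * K) <= 1 / 2 -> inv v ->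
  prefix_mean n (fun b => expR (l * noise v b)) <= (1 + 2 * (l * (2 * K)) ^+ 2) ^+ n.
Proof.
move=> lK; elim: n v => [|n IH] v iv.
  rewrite /prefix_mean (big_pred1 [tuple])/=; last by move=> b; rewrite [b]tuple0 /= eqxx.
  by rewrite big_nil mul1r mulr0 expR0 expr0.
have K_ge0 : 0 <= K by rewrite (le_trans _ (phiK iv)).
set M := 1 + _; have M_ge0 : 0 <= M by rewrite addr_ge0// mulr_ge0// sqr_ge0.
rewrite /prefix_mean (big_tuple_cons _ (fun b => (\prod_(u <- b) pr u) * expR (l * noise v b))).
have -> : \sum_u \sum_(b : n.-tuple T)
      (\prod_(u' <- u :: b) pr u') * expR (l * noise v (u :: b)) =
    fin_mean pr (fun u => expR (l * innovation v u) *
      prefix_mean n (fun b => expR (l * noise (step u v) b))).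
  apply: eq_bigr => u _; rewrite !mulr_sumr; apply: eq_bigr => b _ /=.
  by rewrite big_cons mulrDr expRD; ring.
rewrite (@le_trans _ _ (fin_mean pr (fun u => M ^+ n * (M + l * innovation v u))))//.
  apply: le_fin_mean => u; rewrite mulrC ler_pM ?expR_ge0//.
  - by apply: sumr_ge0 => b _; rewrite mulr_ge0 ?expR_ge0// prodr_ge0// => ? _; rewrite prP.1.
  - exact/IH/step_inv.
  have le_lD : `|l * innovation v u| <= `|l| * (2 * K).
    by rewrite normrM ler_wpM2l// innovation_bounded.
  rewrite (le_trans (expR_le_quadratic _))//.
    by rewrite (le_trans (ler_norm _))// (le_trans le_lD).
  rewrite /M addrAC lerD2r lerD2l ler_wpM2l//.
  rewrite -[leLHS]real_normK ?num_real// -[leRHS]real_normK ?num_real//.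
  by rewrite lerXn2r ?nnegrE// [leRHS]normrM (@ger0_norm _ (2 * K)) ?mulr_ge0.
by rewrite fin_meanZ fin_meanD fin_mean_cst fin_meanZ fin_mean_innovation mulr0 addr0 exprSr.
Qed.

(* The exponential rate [l] is tuned so that [2 (2 l K)^2 = 1 / (2 n)], which keeps
   the moment below [expR (1 / 2) <= 2]. *)
Lemma noise_tail n v (L : R) : (0 < n)%N -> 0 < K -> inv v ->
  \sum_(b : n.-tuple T | 4 * K * Num.sqrt n%:R * L < `|noise v b|)
     \prod_(u <- b) pr u <= 4 * expR (- L).
Proof.
move=> n_gt0 K_gt0 iv.
set l := (4 * K * Num.sqrt n%:R)^-1.
have sn_gt0 : 0 < Num.sqrt n%:R :> R by rewrite sqrtr_gt0 ltr0n.
have l_gt0 : 0 < l by rewrite invr_gt0 !mulr_gt0.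
have sn_ge1 : 1 <= Num.sqrt n%:R :> R by rewrite -[leLHS]sqrtr1 ler_wsqrtr// ler1n.
have lK : l * (2 * K) = (2 * Num.sqrt n%:R)^-1.
  by rewrite /l; field; rewrite !gt_eqF.
have lK2 : `|l| * (2 * K) <= 1 / 2.
  by rewrite gtr0_norm// lK div1r lef_pV2 ?posrE ?mulr_gt0// -[leLHS]mulr1 ler_wpM2l.
have moment (l' : R) : `|l'| = l ->
    prefix_mean n (fun b => expR (l' * noise v b)) <= 2.
  move=> ll'; rewrite (le_trans (noise_moment _ _ iv)) ?ll' -?[X in `|X|]gtr0_norm ?normr_id//.
    by rewrite -(gtr0_norm l_gt0).
  have -> : (l' * (2 * K)) ^+ 2 = (4 * n%:R)^-1.
    rewrite exprMn -[l' ^+ 2]real_normK ?num_real// ll' -exprMn lK exprVn exprMn.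
    by rewrite sqr_sqrtr ?ler0n//; congr (_ * _)^-1; ring.
  have -> : 2 * (4 * n%:R)^-1 = (1 / 2) / n%:R :> R.
    by field; rewrite pnatr_eq0 -lt0n.
  rewrite (@le_trans _ _ (expR (1 / 2)))//.
    have -> : expR (1 / 2) = expR (1 / 2 / n%:R) ^+ n :> R.
      by rewrite -expRM_natl mulrCA mulfV ?mulr1// pnatr_eq0 -lt0n.
    by rewrite lerXn2r ?nnegrE ?expR_ge0 ?expR_ge1Dx// addr_ge0// !divr_ge0.
  (* [expR (1 / 2) <= 2] because [expR (- (1 / 2)) >= 1 - 1 / 2]. *)
  rewrite -[X in expR X]opprK expRN -[leRHS]invrK lef_pV2 ?posrE ?expR_gt0//.
  by rewrite (le_trans _ (expR_ge1Dx _))//; lra.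
have prod_ge0 (b : seq T) : 0 <= \prod_(u <- b) pr u.
  by rewrite prodr_ge0// => u _; rewrite prP.1.
(* Two-sided Chernoff bound: adding the moments at [l] and [- l] handles the absolute value, and
   each is at most 2, whence the factor 4. *)
rewrite (@le_trans _ _ (expR (- L) * (prefix_mean n (fun b => expR (l * noise v b))
    + prefix_mean n (fun b => expR (- l * noise v b)))))//; last first.
  rewrite mulrC ler_wpM2r ?expR_ge0//.
  have -> : 4 = 2 + 2 :> R by ring.
  by rewrite lerD// moment ?normrN// gtr0_norm.
rewrite -big_split/= mulr_sumr big_mkcond/= ler_sum// => b _.
rewrite -mulrDr; case: ifPn => [Lb|_]; last first.
  by rewrite !mulr_ge0 ?expR_ge0 ?addr_ge0 ?expR_ge0.
rewrite mulrCA -[leLHS]mulr1 ler_wpM2l// expRN ler_pdivlMl ?expR_gt0// mulr1.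
have Ll : L <= l * `|noise v b|.
  by rewrite mulrC ler_pdivlMr ?mulr_gt0// mulrC ltW.
rewrite (@le_trans _ _ (expR (l * `|noise v b|))) ?ler_expR//.
by case: (ler0P (noise v b)) => _; rewrite ?mulrN -?mulNr ?lerDl ?lerDr ?expR_ge0.
Qed.

End MarkovNoise.

(** * From finite sequences of minibatches to the probability space *)

Lemma prefix_event (R : realType) (dsp : measure_display) (Om : measurableType dsp)
    (P : probability Om R) (T : finType) (pr : T -> R) (Bs : nat -> Om -> T)
    (n : nat) (Q : pred (seq T)) : is_pmf pr -> iid P pr Bs ->
  measurable [set w | Q (mkseq (Bs ^~ w) n)] /\
  (P [set w | Q (mkseq (Bs ^~ w) n)] <=
     (\sum_(b : n.-tuple T | Q b) \prod_(u <- b) pr u)%:E)%E.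
Proof.
move=> prP [Bs_meas Bs_law Bs_indep].
(* The masses sum to 1, so [T] is inhabited; [u0] serves as the default of [nth]. *)
have [u0 _|T0] := pickP T; last first.
  by have := prP.2; rewrite big_pred0// => /esym/eqP; rewrite oner_eq0.
pose cyl (b : seq T) := \bigcap_(t in [set` iota 0 n]) (Bs t @^-1` [set nth u0 b t]).
have cyl_meas b : measurable (cyl b).
  apply: fin_bigcap_measurable => [|t _]; first exact: finite_seq.
  exact: Bs_meas.
have cylP (b : n.-tuple T) : (P (cyl b) <= (\prod_(u <- b) pr u)%:E)%E.
  rewrite [leLHS](Bs_indep (iota 0 n) (fun t => [set nth u0 b t])) ?iota_uniq//.
  rewrite lee_fin [leRHS](big_nth u0) size_tuple /index_iota subn0.
  by under eq_bigr do rewrite Bs_law.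
(* The event is a finite union of cylinders, one for each word of length [n] satisfying [Q];
   subadditivity then adds up their product masses. *)
have -> : [set w | Q (mkseq (Bs ^~ w) n)] =
    \big[setU/set0]_(b : n.-tuple T | Q b) cyl b.
  rewrite -bigcup_seq_cond; apply/seteqP; split=> w /=.
    move=> Qw; exists [tuple of mkseq (Bs ^~ w) n]; first by rewrite /= mem_index_enum.
    by move=> t /=; rewrite mem_iota => /andP[_ tn]; rewrite nth_mkseq.
  move=> [b /= /andP[_ Qb]] cb; suff -> : mkseq (Bs ^~ w) n = b by [].
  rewrite -[RHS](mkseq_nth u0) size_tuple; apply: (@eq_from_nth _ u0).
    by rewrite !size_mkseq.
  move=> t; rewrite size_mkseq => tn; rewrite !nth_mkseq//.
  by apply: cb; rewrite /= mem_iota.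
elim/big_rec2: _ => [|b s U _ [U_meas PU]]; first by rewrite measure0; split.
split; first exact: measurableU.
by rewrite (le_trans (measureU2 _ _ _))// EFinD; exact: (leeD (cylP b)).
Qed.

(** * The drift of the SGD iterates *)

Lemma sgd_iter_foldl (R : realType) (N m p d : nat)
    (x : 'I_N -> 'cV[R]_p) (y : 'I_N -> 'I_d) (eps gamma eta : R)
    (nn : net R p d) (Bs : nat -> m.-tuple 'I_N) (th : param nn) t :
  sgd_iter eps eta gamma x y Bs th t =
  foldl (fun th' B => sgd_step eps eta gamma x y B th') th (mkseq Bs t).
Proof.
elim: t => [//|t IH].
by rewrite mkseqS foldl_rcons -IH.
Qed.

(** Linearity, and an exchange of the averages over the evaluation batch and the update batch. *)
Lemma fin_mean_diff (R : realType) (T : finType) (pr : T -> R) (V : Type)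
    (f : T -> V -> R) (step : T -> V -> V) (v : V) : is_pmf pr ->
  fin_mean pr (fun b => fin_mean pr (fun u => f b v - f b (step u v))) =
  fin_mean pr (f ^~ v) - fin_mean pr (fun u => fin_mean pr (f ^~ (step u v))).
Proof.
move=> prP; rewrite /fin_mean.
under [X in _ - X]eq_bigr do rewrite mulr_sumr.
rewrite [X in _ - X]exchange_big -sumrB; apply: eq_bigr => b _ /=.
under eq_bigr do rewrite mulrBr.
rewrite sumrB -mulr_suml prP.2 mul1r mulrBr mulr_sumr; congr (_ - _).
by apply: eq_bigr => u _; rewrite mulrCA.
Qed.

Theorem theorem4p4 (R : realType) (N m p d : nat)
    (x : 'I_N -> 'cV[R]_p) (y : 'I_N -> 'I_d)
    (pB : m.-tuple 'I_N -> R) (eps gamma eta : R)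
    (nn : net R p d) (theta1 : param (bn_net nn))
    (hx : forall i, norm2 (x i) <= 1)
    (hm : (0 < m)%N)
    (hpB : is_pmf pB)
    (heps : 0 < eps)
    (hgamma : 0 < gamma)
    (heta : 0 < eta <= 1 / gamma)
    (ha : `|last_scale theta1| <= 2 * Num.sqrt m%:R / gamma) :
  exists C : R,
    forall (dsp : measure_display) (Om : measurableType dsp)
      (P : probability Om R) (Bs : nat -> Om -> m.-tuple 'I_N),
    iid P pB Bs ->
    forall (n : nat) (delta : R), (0 < n)%N -> 0 < delta <= 1 / 2 ->
    ((1 - delta)%R%:E <=
     P [set w | (`| empirical_mean n
                      (sgd_iter eps eta gamma x y (fun t => Bs t w) theta1)
                      (fun theta =>
                         fin_mean pB (fun B =>
                         fin_mean pB (fun B' =>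
                           batch_loss eps x y B theta
                           - batch_loss eps x y B
                               (sgd_step eps eta gamma x y B' theta)))) |
                 <= C * (ln (1 / delta) / Num.sqrt n%:R))%R ])%E.
Proof.
pose M : R := 2 * Num.sqrt m%:R / gamma.
pose K : R := `|2 * (M * Num.sqrt m%:R) + ln d%:R| + 1.
have K_gt0 : 0 < K by rewrite ltr_pwDr.
pose step (B : m.-tuple 'I_N) (th : param (bn_net nn)) := sgd_step eps eta gamma x y B th.
pose phi (th : param (bn_net nn)) : R := fin_mean pB (fun B => batch_loss eps x y B th).
pose inv (th : param (bn_net nn)) := `|last_scale th| <= M.
have step_inv B th : inv th -> inv (step B th) by exact: last_scale_sgd_step.
have phiK th : inv th -> `|phi th| <= K.
  move=> ith; apply: fin_mean_bounded => // B.
  rewrite (le_trans (batch_loss_bounded _ _ _ hm heps ith))//.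
  by rewrite (le_trans (ler_norm _))// lerDl.
have ln2_gt0 : 0 < ln 2 :> R by rewrite ln_gt0// ltr1n.
(* [12 * K] pays for the noise, at level [4 * K * (3 * L)]; [2 * K / ln 2] pays for the two boundary
   values of [phi], since [ln 2 <= L]. *)
exists (12 * K + 2 * K / ln 2) => dsp Om P Bs Bs_iid n delta n_gt0 /andP[d_gt0 d_le].
set L := ln (1 / delta); set C := 12 * K + _.
have sn_gt0 : 0 < Num.sqrt n%:R :> R by rewrite sqrtr_gt0 ltr0n.
have sn_ge1 : 1 <= Num.sqrt n%:R :> R by rewrite -[leLHS]sqrtr1 ler_wsqrtr// ler1n.
have L_ge : ln 2 <= L.
  rewrite ler_ln ?posrE ?divr_gt0// ler_pdivlMr//.
  by move: d_le; lra.
have L_ge0 : 0 <= L by rewrite (le_trans _ L_ge)// ltW.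
(* The factor 3 absorbs the constant of the tail bound: [4 * delta ^+ 3 <= delta] for
   [delta <= 1 / 2]. *)
pose A (b : seq (m.-tuple 'I_N)) :=
  4 * K * Num.sqrt n%:R * (3 * L) < `|noise pB step phi theta1 b|.
have [A_meas PA] := prefix_event n A hpB Bs_iid.
set Bad := [set w | _] in A_meas PA.
have PBad : (P Bad <= delta%:E)%E.
  rewrite (le_trans PA)// lee_fin.
  rewrite (le_trans (noise_tail hpB step_inv phiK _ n_gt0 K_gt0 ha))//.
  have -> : expR (- (3 * L)) = delta ^+ 3.
    rewrite /L div1r lnV ?posrE// mulrN opprK expRM_natl lnK ?posrE//.
  have -> : 4 * delta ^+ 3 = (4 * delta ^+ 2) * delta by ring.
  rewrite -[leRHS]mul1r ler_wpM2r ?(ltW d_gt0)//.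
  by nra.
set f : param (bn_net nn) -> R := fun theta => fin_mean pB _.
have fE th : f th = phi th - fin_mean pB (fun B => phi (step B th)).
  exact: (fin_mean_diff (fun B th => batch_loss eps x y B th)).
have emE w : empirical_mean n (sgd_iter eps eta gamma x y (fun t => Bs t w) theta1) f =
    n%:R^-1 * (phi theta1 - phi (foldl (fun th B => step B th) theta1 (mkseq (Bs ^~ w) n))
      + noise pB step phi theta1 (mkseq (Bs ^~ w) n)).
  rewrite -sum_drift_noise /empirical_mean; congr (_ * _); apply: eq_bigr => t _.
  by rewrite sgd_iter_foldl fE.
(* The target event as a predicate on the first [n] minibatches, so that [prefix_event] yields its
   measurability. *)
pose G (b : seq (m.-tuple 'I_N)) :=
  `|n%:R^-1 * (phi theta1 - phi (foldl (fun th B => step B th) theta1 b)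
      + noise pB step phi theta1 b)| <= C * (L / Num.sqrt n%:R).
have -> : [set w | `|empirical_mean n
     (sgd_iter eps eta gamma x y (fun t => Bs t w) theta1) f| <= C * (L / Num.sqrt n%:R)] =
    [set w | G (mkseq (Bs ^~ w) n)].
  by apply/seteqP; split=> w /=; rewrite emE.
have [G_meas _] := prefix_event n G hpB Bs_iid.
rewrite (@le_trans _ _ (P (~` Bad)))//.
  by rewrite probability_setC// EFinB leeB.
apply: le_measure; rewrite ?inE//; first exact: measurableC.
move=> w /negP; rewrite /A -leNgt /= => noise_le.
rewrite /G normrM gtr0_norm ?invr_gt0 ?ltr0n// mulrC ler_pdivrMr ?ltr0n//.
have -> : C * (L / Num.sqrt n%:R) * n%:R =
    4 * K * Num.sqrt n%:R * (3 * L) + 2 * K * (L / ln 2 * Num.sqrt n%:R).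
  rewrite -[X in _ * X = _](@sqr_sqrtr _ n%:R) ?ler0n// /C.
  by field; rewrite !gt_eqF.
rewrite (le_trans (ler_normD _ _))// addrC lerD//.
(* The boundary terms are at most [2 * K], and both [L / ln 2] and [Num.sqrt n%:R] are at least
   1. *)
rewrite (@le_trans _ _ (2 * K))//.
  rewrite mulr_natl mulr2n (le_trans (ler_normB _ _))// lerD ?phiK//.
  exact: (state_inv step_inv).
rewrite -[leLHS]mulr1 ler_wpM2l ?mulr_ge0 ?(ltW K_gt0)//.
by rewrite mulr_ege1// ler_pdivlMr// mul1r.
Qed.
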